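(* Let $n\ge 2$. For every composition $c$ of $n$, $\mu(c')=\nu(c)$ and $\nu(c')=\mu(c)$, where $c'$ denotes the conjugate of $c$.
   Context: A composition of $n$ is a finite sequence $(c_1,\ldots,c_k)$ of positive integers with sum $n$. It corresponds bijectively to the subset $\{c_1,\,c_1+c_2,\,\ldots,\,c_1+\cdots+c_{k-1}\}$ of $[n-1]$, and a subset $S\subseteq[n-1]$ corresponds bijectively to the word $w_1\cdots w_{n-1}$ over $\{N,E\}$ with $w_i=N$ if $i\in S$ and $w_i=E$ otherwise. The conjugate $c'$ of $c$ is obtained by passing to this word, interchanging every $N$ with $E$ and every $E$ with $N$, and passing back to a composition of $n$. A part is big if it is $\ge 2$ and small if it equals $1$. Each part has as neighbors the parts immediately before and after it in the sequence (no wraparound), so end parts have one neighbor and the part of a one-part composition has none. Define $\mu(c)$ = sum of the big parts of $c$, and $\nu(c)$ = (sum of the small parts of $c$) + (total number of neighbors of the big parts of $c$). *)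

(* Defs.v *)
From mathcomp Require Import all_boot.

Set Implicit Arguments.
Unset Strict Implicit.
Unset Printing Implicit Defensive.

Definition is_composition (n : nat) (c : seq nat) : bool :=
  all (fun x => 0 < x) c && (sumn c == n).

Inductive letter := North | East.

Definition swap (l : letter) : letter :=
  if l is North then East else North.

(* A subset of [n-1] = {1, ..., n-1} is encoded as a set S : {set 'I_n.-1};
   the ordinal i, which ranges over 0, ..., n-2, stands for the integer i.+1. *)

(* The partial sums c_1 + ... + c_j for 1 <= j <= k-1, where k is the number
   of parts: the full sum is left out. *)
Definition proper_partial_sums (c : seq nat) : seq nat :=
  [seq sumn (take j c) | j <- iota 1 (size c).-1].

Definition set_of_composition (n : nat) (c : seq nat) : {set 'I_n.-1} :=
  [set i : 'I_n.-1 | i.+1 \in proper_partial_sums c].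

Definition word_of_set (n : nat) (S : {set 'I_n.-1}) : n.-1.-tuple letter :=
  [tuple if i \in S then North else East | i < n.-1].

Definition set_of_word (n : nat) (w : n.-1.-tuple letter) : {set 'I_n.-1} :=
  [set i : 'I_n.-1 | if tnth w i is North then true else false].

(* If S = {s_1 < ... < s_(k-1)}, the composition is
   (s_1 - 0, s_2 - s_1, ..., n - s_(k-1)); enum lists S in increasing order. *)
Definition composition_of_set (n : nat) (S : {set 'I_n.-1}) : seq nat :=
  pairmap (fun a b => b - a) 0 (rcons [seq (val i).+1 | i <- enum S] n).

Definition conjugate (n : nat) (c : seq nat) : seq nat :=
  composition_of_set (set_of_word
    (map_tuple swap (word_of_set (set_of_composition n c)))).

Definition big (x : nat) : bool := 2 <= x.
Definition small (x : nat) : bool := x == 1.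

Definition num_neighbors (c : seq nat) (i : 'I_(size c)) : nat :=
  #|[set j : 'I_(size c) | (j.+1 == i :> nat) || (i.+1 == j :> nat)]|.

Definition mu (c : seq nat) : nat := \sum_(x <- c | big x) x.

(* Neighbors are counted once for each big part they are adjacent to: a part
   lying between two big parts contributes 2. *)
Definition nu (c : seq nat) : nat :=
  \sum_(x <- c | small x) x +
  \sum_(i < size c | big (nth 0 c i)) num_neighbors i.

(* Main.v *)
Require Import Defs.
From mathcomp Require Import all_boot.
From mathcomp Require Import zify.

(** Cut a strip of [n] cells at the places marked [N] by the word of [c]: the
    parts of [c] are the pieces. The cells touching a letter [E] are exactly the
    cells lying in big parts, so [mu c] counts them. The cells touching a letter
    [N] are the small parts and, in each big part, the first cell if there is a
    left neighbor and the last cell if there is a right one, so [nu c] counts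
    them. Conjugation exchanges the two letters. *)

(* [true] is the letter N. *)
Fixpoint cut_word (c : seq nat) : seq bool :=
  match c with
  | [::] => [::]
  | [:: x] => nseq x.-1 false
  | x :: s => nseq x.-1 false ++ true :: cut_word s
  end.

(* The number of cells touching a letter [true], among the cells separated by
   the letters of [w]; [l] stands for the letter to the left of the first cell. *)
Fixpoint num_touching (l : bool) (w : seq bool) : nat :=
  if w is b :: w' then (l || b) + num_touching b w' else l.

Lemma num_touching_nseq_false l k :
  num_touching l (nseq k false) = l.
Proof. by elim: k l => [|k IHk] l //=; rewrite IHk orbF addn0. Qed.

(** A big part of [k.+2] cells before a cut: the last cell touches the cut, the first one touches
    [l], and those between touch no [true]. *)
Lemma num_touching_nseq_false_cat l k w :
  num_touching l (nseq k.+1 false ++ true :: w) = l.+1 + num_touching true w.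
Proof.
rewrite /= orbF addSnnS; congr (_ + _).
by elim: k => [|k IHk] //=; rewrite IHk.
Qed.

Lemma num_touching_nseq_true k :
  num_touching true (nseq k true) = k.+1.
Proof. by elim: k => [|k IHk] //=; rewrite IHk. Qed.

Lemma num_touching_nseq_true_cat k w :
  num_touching true (nseq k true ++ false :: w) = k.+1 + num_touching false w.
Proof. by elim: k => [|k IHk] //=; rewrite IHk. Qed.

(** Negated cuts are [false], so each part again starts with [false] on its left and the induction
    keeps that value. *)
Lemma mu_num_touching c :
  all (fun x => 0 < x) c -> mu c = num_touching false (map negb (cut_word c)).
Proof.
rewrite /mu; elim: c => [|x s IHs] /=; first by rewrite big_nil.
case/andP=> x_gt0 /IHs {}IHs; rewrite big_cons {}IHs.
case: s => [|y s].
  by case: x x_gt0 => [|[|k]] //= _; rewrite map_nseq num_touching_nseq_true addn0.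
rewrite map_cat map_nseq [map _ (_ :: _)]/=; case: x x_gt0 => [|[|k]] // _.
by rewrite [_.-1]/= [nseq _.+1 _]/= [LHS]/= [RHS]/= num_touching_nseq_true_cat.
Qed.

Lemma sum_ord_eq n k : \sum_(j < n) (j == k :> nat) = (k < n).
Proof.
elim: n => [|n IHn]; first by rewrite big_ord0.
by rewrite big_ord_recr /= IHn; lia.
Qed.

Lemma num_neighborsE c (i : 'I_(size c)) :
  num_neighbors i = (0 < i) + (i.+1 < size c).
Proof.
rewrite /num_neighbors -sum1_card big_mkcond /=.
(* The two conditions exclude each other, so the disjunction is a sum. *)
rewrite (eq_bigr (fun j : 'I_(size c) => (j.+1 == i) + (j == i.+1 :> nat))).
  rewrite big_split /= sum_ord_eq; congr (_ + _).
  case: i => [[|i] lt_i] /=; first by rewrite big1.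
  under eq_bigr do rewrite eqSS.
  by rewrite sum_ord_eq ltnW.
by move=> j _; rewrite inE; move: (val i) (val j) => k m /=; case: ifP; lia.
Qed.

(* For [c = (1)] and no letter on the left, the only cell touches nothing. *)
Lemma num_touching_cut_word l c :
  all (fun x => 0 < x) c -> c != [::] -> l || (c != [:: 1]) ->
  num_touching l (cut_word c) = \sum_(x <- c | small x) x +
    \sum_(i < size c | big (nth 0 c i)) ((l || (0 < i)) + (i.+1 < size c)).
Proof.
elim: c l => [|x s IHs] l //= /andP[x_gt0 s_gt0] _ l_or.
rewrite big_cons [X in _ = _ + X]big_mkcond big_ord_recl /= -big_mkcond orbF.
case: s => [|y s] in IHs s_gt0 l_or *.
  rewrite big_nil big_ord0 num_touching_nseq_false.
  by case: x x_gt0 l_or => [|[|k]] // _; rewrite /small /big /=; case: l.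
(* The cut after [x] is the letter to the left of the tail. *)
have {IHs} := IHs true s_gt0 isT isT.
set t := y :: s; under [in X in _ -> _ = _ + X]eq_bigr do rewrite orbT ltnS.
rewrite /= => IHs.
set B := \sum_(i < _ | big _) _ in IHs; rewrite -[X in _ = _ + (_ + X)]/B.
case: x x_gt0 {l_or} => [|[|k]] // _.
  by rewrite [LHS]/= orbT IHs /small /big /=; lia.
rewrite [_.+2.-1]/= -/t in IHs *.
rewrite num_touching_nseq_false_cat IHs /small /big /=; lia.
Qed.

Lemma nu_num_touching c :
  all (fun x => 0 < x) c -> 1 < sumn c ->
  nu c = num_touching false (cut_word c).
Proof.
move=> c_gt0 n_gt1; rewrite num_touching_cut_word //;
  try by apply: contraTneq n_gt1 => ->.
by congr (_ + _); apply: eq_bigr => i _; rewrite num_neighborsE.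
Qed.

Lemma proper_partial_sums_cons x y s :
  proper_partial_sums [:: x, y & s] =
    x :: map (addn x) (proper_partial_sums (y :: s)).
Proof.
rewrite /proper_partial_sums /= addn0 -map_comp; congr (_ :: _).
by rewrite (iotaDl 1 1) -map_comp; apply: eq_map => j.
Qed.

Lemma size_cut_word c :
  all (fun x => 0 < x) c -> size (cut_word c) = (sumn c).-1.
Proof.
elim: c => [|x [|y s] IHs] //=.
  by rewrite size_nseq addn0.
case/and3P=> x_gt0 y_gt0 s_gt0.
have {}IHs := IHs (introT andP (conj y_gt0 s_gt0)).
rewrite size_cat size_nseq [size (_ :: _)]/= IHs /=; lia.
Qed.

(** Letter [i], counted from 0, has [i.+1] cells to its left. *)
Lemma nth_cut_word c i :
  all (fun x => 0 < x) c ->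
  nth false (cut_word c) i = (i.+1 \in proper_partial_sums c).
Proof.
elim: c i => [|x [|y s] IHs] i; first by rewrite nth_nil.
  by rewrite /= nth_nseq if_same.
case/andP=> x_gt0 s_gt0.
rewrite proper_partial_sums_cons inE [cut_word _]/= nth_cat size_nseq nth_nseq.
have mem_shift j : (j \in map (addn x) (proper_partial_sums (y :: s))) =
    (x <= j) && (j - x \in proper_partial_sums (y :: s)).
  apply/mapP/andP => [[k k_s ->]|[le_xj j_s]]; first by rewrite leq_addr addKn.
  by exists (j - x); rewrite ?subnKC.
rewrite mem_shift; case: ltngtP => [lt_ix|lt_xi|eq_ix].
- have lt_i1x : i.+1 < x by rewrite -ltn_predRL.
  by rewrite ltn_eqF // leqNgt lt_i1x.
- have le_xi : x <= i by rewrite -(prednK x_gt0).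
  (* The successor steps over the letter of the first cut. *)
  have -> : i - x.-1 = (i - x).+1 by rewrite -subSn // -{2}(prednK x_gt0) subSS.
  rewrite /= IHs // subSn //.
  by rewrite gtn_eqF // (leqW le_xi).
- by rewrite eq_ix subnn prednK // eqxx.
Qed.

Section Differences.

Local Notation differences := (pairmap (fun a b => b - a)).

(** The sums telescope; leaving out the full sum drops the entry [n]. *)
Lemma proper_partial_sums_differences a s n :
  path ltn a (rcons s n) ->
  proper_partial_sums (differences a (rcons s n)) = map (subn^~ a) s.
Proof.
elim: s a => [|x s IHs] a //= /andP[lt_ax path_s].
have := IHs x path_s; case Ed: (differences x (rcons s n)) => [|y t] IH.
  by case: (s) Ed.
rewrite proper_partial_sums_cons IH -map_comp; congr (_ :: _).
apply/eq_in_map => y' y'_s /=.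
(* Truncated subtraction telescopes only along increasing entries. *)
have : x < y'.
  have /allP := order_path_min ltn_trans path_s.
  by apply; rewrite mem_rcons inE y'_s orbT.
by move: lt_ax => /=; lia.
Qed.

Lemma is_composition_differences s n :
  path ltn 0 (rcons s n) -> is_composition n (differences 0 (rcons s n)).
Proof.
(* Writing [n] as [n - 0] lets the induction replace 0 by any start [a], with total [n - a]. *)
rewrite -[n in is_composition n]subn0.
elim: s 0 => [|x s IHs] a /=.
  by rewrite andbT /is_composition /= subn_gt0 addn0 eqxx => ->.
case/andP=> lt_ax path_s; have /andP[d_gt0 /eqP sum_d] := IHs x path_s.
have : x < n.
  have /allP := order_path_min ltn_trans path_s.
  by apply; rewrite mem_rcons mem_head.
rewrite /is_composition /= d_gt0 sum_d; lia.
Qed.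

End Differences.

Lemma path_ltn_enum n (S : {set 'I_n.-1}) :
  0 < n -> path ltn 0 (rcons [seq (val i).+1 | i <- enum S] n).
Proof.
move=> n_gt0; rewrite -cats1 cat_path /= andbT.
set s := map _ _.
have s_sorted : sorted ltn s.
  rewrite sorted_map; apply: sorted_filter => [i j k|]; first exact: ltn_trans.
  by rewrite -enumT -[sorted _ _](sorted_map (e' := ltn) (f := val)) val_enum_ord iota_ltn_sorted.
have s_mem k : k \in s -> 0 < k < n.
  by case/mapP=> i _ ->; have := ltn_ord i => /=; lia.
apply/andP; split.
  rewrite path_min_sorted //; apply/allP => k /s_mem /andP[] //.
case Es: s => [|x t] //=.
by have /andP[] : 0 < last x t < n by apply: s_mem; rewrite Es mem_last.
Qed.

Lemma is_composition_of_set n (S : {set 'I_n.-1}) :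
  0 < n -> is_composition n (composition_of_set S).
Proof. by move=> n_gt0; apply/is_composition_differences/path_ltn_enum. Qed.

Lemma composition_of_setK n (S : {set 'I_n.-1}) :
  0 < n -> set_of_composition n (composition_of_set S) = S.
Proof.
move=> n_gt0; apply/setP => i; rewrite inE.
rewrite proper_partial_sums_differences ?path_ltn_enum // -map_comp.
rewrite (eq_map (g := fun i : 'I_n.-1 => (val i).+1)); last by move=> j /=; rewrite subn0.
by rewrite (mem_map (f := fun i : 'I_n.-1 => (val i).+1)) ?mem_enum // => j k [] /val_inj.
Qed.

(** Both words have [n.-1] letters, and letter [i] tells whether [i.+1] is a partial sum. By
    [composition_of_setK], the partial sums of the conjugate form the complementary set. *)
Lemma cut_word_conjugate n c :
  0 < n -> is_composition n c ->
  cut_word (conjugate n c) = map negb (cut_word c).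
Proof.
move=> n_gt0 /andP[c_gt0 /eqP sum_c].
have /andP[d_gt0 /eqP sum_d] : is_composition n (conjugate n c).
  exact: is_composition_of_set.
have size_c : size (cut_word c) = n.-1 by rewrite size_cut_word ?sum_c.
apply: (@eq_from_nth _ false); first by rewrite size_map size_c size_cut_word ?sum_d.
rewrite size_cut_word // sum_d => i lt_in.
rewrite (nth_map false) ?size_c // !nth_cut_word //.
have := composition_of_setK n (set_of_word
  (map_tuple swap (word_of_set (set_of_composition n c)))) n_gt0.
move/setP/(_ (Ordinal lt_in)); rewrite inE /= => ->.
by rewrite inE tnth_map tnth_mktuple inE /=; case: ifP.
Qed.

Theorem theorem3 (n : nat) (hn : 2 <= n) (c : seq nat)
    (hc : is_composition n c) :
  mu (conjugate n c) = nu c /\ nu (conjugate n c) = mu c.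
Proof.
have n_gt0 : 0 < n by apply: ltnW.
have /andP[c_gt0 /eqP sum_c] := hc.
have /andP[d_gt0 /eqP sum_d] : is_composition n (conjugate n c).
  exact: is_composition_of_set.
rewrite !mu_num_touching ?nu_num_touching ?sum_c ?sum_d //.
(* In the first equation the letters are negated twice, which gives back the word of [c]. *)
by rewrite cut_word_conjugate // mapK //; apply: negbK.
Qed.
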